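(* Let $X$ be an hls-space. Then $X$ is hls-normal if and only if for every closed subset $A$ of $X$, every continuous slowly oscillating function $f: A \rightarrow [0,1]$ extends to a continuous slowly oscillating function $g: X \rightarrow [0,1]$.
   Context: For $B\subseteq X$ and a family $\mathcal{U}$ of subsets of $X$, $\mathrm{st}(B,\mathcal{U})$ is the union of the elements of $\mathcal{U}$ meeting $B$; for a family $\mathcal{B}$, $\mathrm{st}(\mathcal{B},\mathcal{U})=\{\mathrm{st}(B,\mathcal{U})\mid B\in\mathcal{B}\}$. A large scale structure (ls-structure) on a set $X$ is a nonempty collection $\mathcal{L}$ of families of subsets of $X$ (the uniformly bounded families) such that: (i) if $\mathcal{B}_1\in\mathcal{L}$ and each element of $\mathcal{B}_2$ having more than one point is contained in some element of $\mathcal{B}_1$, then $\mathcal{B}_2\in\mathcal{L}$; (ii) $\mathcal{B}_1,\mathcal{B}_2\in\mathcal{L}$ implies $\mathrm{st}(\mathcal{B}_1,\mathcal{B}_2)\in\mathcal{L}$. An ls-space is a set with an ls-structure. A hybrid large scale space (hls-space) is a set with an ls-structure and a topology such that some uniformly bounded cover consists of open sets. A subset $A\subseteq X$ carries the subspace topology and the subspace ls-structure (the families of subsets of $A$ that are uniformly bounded in $X$). A subset is bounded if it is an element of some uniformly bounded cover. The coarse component of a point $x$ is the union of all bounded sets containing $x$. A subset is weakly bounded if its intersection with every coarse component is bounded. A map $f:X\to M$ to a metric space is slowly oscillating if for every uniformly bounded family $\mathcal{U}$ and every $\varepsilon>0$ there is a weakly bounded set $K$ such that $\mathrm{diam}(f(U))<\varepsilon$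 for every $U\in\mathcal{U}$ with $U\cap K=\varnothing$. $N$ is a coarse neighbourhood of $A$ if $A\subseteq N$ and for every uniformly bounded cover $\mathcal{U}$, $\mathrm{st}(A,\mathcal{U})\subseteq N\cup K$ for some weakly bounded $K$. $N$ is a topological neighbourhood of $A$ if $N$ contains an open set containing $\mathrm{cl}(A)$. $N$ is a hybrid neighbourhood of $A$ if it is both a topological and a coarse neighbourhood of $A$. An hls-space $X$ is hls-normal if for every closed $A\subseteq X$ and every hybrid neighbourhood $N$ of $A$ there is a closed $V\subseteq X$ such that $V$ is a hybrid neighbourhood of $A$ and $N$ is a hybrid neighbourhood of $V$. *)

(* Defs.v *)
From HB Require Import structures.
From mathcomp Require Import all_boot all_order all_algebra.
From mathcomp Require Import all_classical all_reals ereal topology normedtype.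

Set Implicit Arguments.
Unset Strict Implicit.
Unset Printing Implicit Defensive.

Import Order.TTheory GRing.Theory Num.Theory.
Import numFieldNormedType.Exports.

Local Open Scope classical_set_scope.
Local Open Scope ring_scope.

Definition star {X : Type} (B : set X) (U : set (set X)) : set X :=
  \bigcup_(C in [set C | U C /\ C `&` B !=set0]) C.

Definition stars {X : Type} (BB U : set (set X)) : set (set X) :=
  [set star B U | B in BB].

Definition more_than_one_point {X : Type} (B : set X) : Prop :=
  exists x y, [/\ B x, B y & x <> y].

HB.mixin Record isLargeScale (X : Type) := {
  unif_bounded : set (set (set X)) ;
  unif_bounded_nonempty : unif_bounded !=set0 ;
  unif_bounded_refine : forall B1 B2 : set (set X), unif_bounded B1 ->
    (forall B, B2 B -> more_than_one_point B -> exists2 C, B1 C & B `<=` C) ->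
    unif_bounded B2 ;
  unif_bounded_stars : forall B1 B2 : set (set X),
    unif_bounded B1 -> unif_bounded B2 -> unif_bounded (stars B1 B2)
}.

#[short(type="lsType")]
HB.structure Definition LargeScale := { X of isLargeScale X }.

Definition unif_bounded_cover {X : lsType} (U : set (set X)) : Prop :=
  unif_bounded U /\ \bigcup_(B in U) B = setT.

HB.mixin Record LargeScale_Topological_isHybrid X
    of Topological X & LargeScale X := {
  open_unif_bounded_cover :
    exists2 U : set (set X), unif_bounded_cover U & forall B, U B -> open B
}.

#[short(type="hlsType")]
HB.structure Definition HybridLargeScale :=
  { X of Topological X & LargeScale X & LargeScale_Topological_isHybrid X }.

Section subspace_large_scale.
Context {X : lsType} (A : set X).

Let image_family (V : set (set A)) : set (set X) :=
  [set (set_val : A -> X) @` B | B in V].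

(* A family of subsets of the subtype A, pushed into X along the inclusion. *)
Definition sub_unif_bounded : set (set (set A)) :=
  [set V | unif_bounded (image_family V)].

Let sub_nonempty : sub_unif_bounded !=set0.
Proof.
have [B0 uB0] := @unif_bounded_nonempty X.
exists set0; apply: (unif_bounded_refine _ _ uB0) => B [C []].
Qed.

Let sub_refine (B1 B2 : set (set A)) : sub_unif_bounded B1 ->
  (forall B, B2 B -> more_than_one_point B -> exists2 C, B1 C & B `<=` C) ->
  sub_unif_bounded B2.
Proof.
move=> u1 B21; apply: (unif_bounded_refine _ _ u1) => _ [B B2B <-] [x [y [Bx By xy]]].
case: Bx By xy => [a Ba <-] [b Bb <-] ab.
have [|C B1C BC] := B21 _ B2B; first by exists a, b; split=> // ?; subst.
exists (set_val @` C); first by exists C.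
by move=> _ [z Bz <-]; exists z => //; exact: BC.
Qed.

Let sub_stars (B1 B2 : set (set A)) :
  sub_unif_bounded B1 -> sub_unif_bounded B2 -> sub_unif_bounded (stars B1 B2).
Proof.
move=> u1 u2; apply: (unif_bounded_refine _ _ (unif_bounded_stars _ _ u1 u2)).
move=> _ [_ [B B1B <-] <-] _.
exists (star (set_val @` B) (image_family B2)).
  by exists (set_val @` B) => //; exists B.
move=> _ [x [C [B2C [z [Cz Bz]]] Cx] <-].
exists (set_val @` C); last by exists x.
by split; [exists C | exists (set_val z); split; exists z].
Qed.

HB.instance Definition _ :=
  isLargeScale.Build (set_type A) sub_nonempty sub_refine sub_stars.

End subspace_large_scale.

Section subspace_hybrid.
Context {X : hlsType} (A : set X).

Let sub_open_cover :
  exists2 U : set (set A), unif_bounded_cover U & forall B, U B -> open B.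
Proof.
have [U [uU cU] oU] := @open_unif_bounded_cover X.
exists [set (set_val : A -> X) @^-1` B | B in U]; last first.
  by move=> _ [B UB <-]; exists B => //; exact: oU.
split.
  apply: (unif_bounded_refine _ _ uU) => _ [_ [B UB <-] <-] _.
  by exists B => // _ [x Bx <-].
apply/seteqP; split=> // x _.
have : (\bigcup_(B in U) B) (set_val x) by rewrite cU.
by case=> B UB Bx; exists (set_val @^-1` B) => //; exists B.
Qed.

HB.instance Definition _ :=
  LargeScale_Topological_isHybrid.Build (set_type A) sub_open_cover.

End subspace_hybrid.

Section large_scale_notions.
Context {X : lsType}.
Implicit Types (A B K N : set X) (x : X).

Definition ls_bounded B : Prop :=
  exists2 U : set (set X), unif_bounded_cover U & U B.

Definition coarse_component x : set X :=
  \bigcup_(B in [set B | ls_bounded B /\ B x]) B.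

Definition weakly_bounded K : Prop :=
  forall x, ls_bounded (K `&` coarse_component x).

Definition coarse_neighbourhood A N : Prop :=
  A `<=` N /\ forall U : set (set X), unif_bounded_cover U ->
    exists2 K, weakly_bounded K & star A U `<=` N `|` K.

End large_scale_notions.

(* Inserting 0 only matters for the empty set, so that diam set0 = 0. *)
Definition diam {R : realType} {M : metricType R} (B : set M) : \bar R :=
  ereal_sup (0%E |` [set (mdist p.1 p.2)%:E | p in B `*` B]).

Definition slowly_oscillating {R : realType} {X : lsType} {M : metricType R}
    (f : X -> M) : Prop :=
  forall U : set (set X), unif_bounded U -> forall e : R, 0 < e ->
    exists2 K : set X, weakly_bounded K &
      forall B, U B -> B `&` K = set0 -> (diam (f @` B) < e%:E)%E.

Definition topological_neighbourhood {X : topologicalType} (A N : set X) :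
    Prop :=
  exists U : set X, [/\ open U, closure A `<=` U & U `<=` N].

Definition hybrid_neighbourhood {X : hlsType} (A N : set X) : Prop :=
  topological_neighbourhood A N /\ coarse_neighbourhood A N.

Definition hls_normal (X : hlsType) : Prop :=
  forall A N : set X, closed A -> hybrid_neighbourhood A N ->
    exists V : set X,
      [/\ closed V, hybrid_neighbourhood A V & hybrid_neighbourhood V N].

(* Main.v *)
(* Weakly bounded sets form an ideal stable under stars, so "slowly oscillating"
   means that for every uniformly bounded U and e > 0 the points sharing an
   element of U with a point at which f differs by more than e form a weakly
   bounded set. A function f : X -> [0,1] is continuous and slowly oscillating
   as soon as {f <= s} is a hybrid neighbourhood of {f <= r} for all r < s, so
   a dyadic chain of hybrid neighbourhoods yields Urysohn functions, and
   Tietze's iteration extends functions, since both properties survive uniform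
   limits. Conversely, if N is a hybrid neighbourhood of A then so is its
   interior, because X has a uniformly bounded open cover; extending the
   function equal to 0 on A and 1 off the interior of N and taking {g <= 1/2}
   gives the interpolating set. *)
Require Import Defs.
From HB Require Import structures.
From mathcomp Require Import all_boot all_order all_algebra.
From mathcomp Require Import all_classical all_reals ereal topology normedtype.
From mathcomp Require Import ring lra.
Import Order.TTheory GRing.Theory Num.Theory.
Import numFieldNormedType.Exports.
Local Open Scope classical_set_scope.
Local Open Scope ring_scope.

(** * Bounded sets, coarse components and the ideal of weakly bounded sets *)

Section LargeScaleTheory.
Context {X : lsType}.
Implicit Types (A B C K L N : set X) (x y z : X) (U V : set (set X)).

Lemma starS A B U : A `<=` B -> star A U `<=` star B U.
Proof.
move=> AB x [C [UC [z [Cz Az]]] Cx].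
by exists C => //; split=> //; exists z; split=> //; exact: AB.
Qed.

Lemma sub_star_cover A U : \bigcup_(B in U) B = setT -> A `<=` star A U.
Proof.
move=> cU x Ax; have : (\bigcup_(B in U) B) x by rewrite cU.
by case=> B UB Bx; exists B => //; split=> //; exists x.
Qed.

(** Refinement constrains only elements with more than one point, so [[set B]] together with all
    singletons is a uniformly bounded cover. *)
Lemma ls_boundedP B : ls_bounded B <-> unif_bounded [set B].
Proof.
split=> [[U [uU _] UB]|uB].
  by apply: (unif_bounded_refine _ _ uU) => _ -> _; exists B.
exists [set C | C = B \/ exists x, C = [set x]]; last by left.
split; last by apply/seteqP; split=> // x _; exists [set x] => //; right; exists x.
apply: (unif_bounded_refine _ _ uB) => C [->|[x ->]]; first by exists B.
by move=> [y [z [/= -> -> /(_ erefl)]]].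
Qed.

Lemma sub_ls_bounded B C : B `<=` C -> ls_bounded C -> ls_bounded B.
Proof.
move=> BC /ls_boundedP uC; apply/ls_boundedP.
by apply: (unif_bounded_refine _ _ uC) => _ -> _; exists C.
Qed.

Lemma unif_bounded_ls_bounded U B : unif_bounded U -> U B -> ls_bounded B.
Proof.
move=> uU UB; apply/ls_boundedP.
by apply: (unif_bounded_refine _ _ uU) => _ -> _; exists B.
Qed.

Lemma unif_bounded_coverU U :
  unif_bounded U -> unif_bounded_cover (U `|` range (fun x => [set x])).
Proof.
move=> uU; split.
  apply: (unif_bounded_refine _ _ uU) => B [UB|[x _ <-]]; first by exists B.
  by move=> [y [z [/= -> -> /(_ erefl)]]].
by apply/seteqP; split=> // x _; exists [set x] => //; right; exists x.
Qed.

Lemma ls_bounded_star B U : ls_bounded B -> unif_bounded U ->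
  ls_bounded (star B U).
Proof.
move=> /ls_boundedP uB uU.
by apply: unif_bounded_ls_bounded (unif_bounded_stars _ _ uB uU) _; exists B.
Qed.

(** The union lies in the star of [B] with respect to a cover that contains [C]. *)
Lemma ls_boundedU B C :
  ls_bounded B -> ls_bounded C -> B `&` C !=set0 -> ls_bounded (B `|` C).
Proof.
move=> bB [U [uU cU] UC] BC; apply: sub_ls_bounded (ls_bounded_star _ _ bB uU).
move=> x [Bx|Cx]; first exact: sub_star_cover.
by exists C => //; split=> //; rewrite setIC.
Qed.

Lemma coarse_componentP x y : coarse_component x y <-> ls_bounded [set x; y].
Proof.
split=> [[B [bB Bx] By]|b]; first by apply: sub_ls_bounded bB => _ [->|->].
by exists [set x; y]; [split=> //; left|right].
Qed.

Lemma coarse_component_sym x y : coarse_component x y -> coarse_component y x.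
Proof. by move=> /coarse_componentP; rewrite setUC => /coarse_componentP. Qed.

Lemma coarse_component_trans x y z :
  coarse_component x y -> coarse_component y z -> coarse_component x z.
Proof.
move=> /coarse_componentP xy /coarse_componentP yz; apply/coarse_componentP.
apply: sub_ls_bounded (ls_boundedU _ _ xy yz _); last by exists y; split; [right|left].
by move=> _ [->|->]; [left; left|right; right].
Qed.

Lemma sub_coarse_component x B : ls_bounded B -> B x -> B `<=` coarse_component x.
Proof. by move=> bB Bx y By; exists B. Qed.

Lemma ls_bounded0 : ls_bounded (set0 : set X).
Proof.
have [U uU] := @unif_bounded_nonempty X; apply/ls_boundedP.
by apply: (unif_bounded_refine _ _ uU) => _ -> [x [y []]].
Qed.

Lemma weakly_bounded0 : weakly_bounded (set0 : set X).
Proof. by move=> x; rewrite set0I; exact: ls_bounded0. Qed.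

Lemma sub_weakly_bounded K L : K `<=` L -> weakly_bounded L -> weakly_bounded K.
Proof. by move=> KL wL x; apply: sub_ls_bounded (wL x); exact: setSI. Qed.

(** Two bounded pieces of one coarse component may be disjoint; adjoining the base point [x] to each
    makes them meet. *)
Lemma ls_bounded_setU1 x B :
  ls_bounded B -> B !=set0 -> B `<=` coarse_component x -> ls_bounded (x |` B).
Proof.
move=> bB [b Bb] Bx; have /coarse_componentP xb := Bx _ Bb.
apply: sub_ls_bounded (ls_boundedU _ _ xb bB _); last first.
  by exists b; split=> //; right.
by move=> y [->|By]; [left; left|right].
Qed.

Lemma weakly_boundedU K L :
  weakly_bounded K -> weakly_bounded L -> weakly_bounded (K `|` L).
Proof.
move=> wK wL x; rewrite setIUl.
have [K0|/nonemptyPn->] := pselect ((K `&` coarse_component x) !=set0); last first.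
  by rewrite set0U.
have [L0|/nonemptyPn->] := pselect ((L `&` coarse_component x) !=set0); last first.
  by rewrite setU0.
have bK := ls_bounded_setU1 _ _ (wK x) K0 (@subIsetr _ _ _).
have bL := ls_bounded_setU1 _ _ (wL x) L0 (@subIsetr _ _ _).
apply: sub_ls_bounded (ls_boundedU _ _ bK bL _); last by exists x; split; left.
by move=> y [Ky|Ly]; [left; right|right; right].
Qed.

Lemma weakly_bounded_bigcup (F : nat -> set X) n :
  (forall i, weakly_bounded (F i)) -> weakly_bounded (\bigcup_(i in `I_n) F i).
Proof.
move=> wF; elim: n => [|n IHn].
  by rewrite II0 bigcup_set0; exact: weakly_bounded0.
apply: sub_weakly_bounded (weakly_boundedU _ _ IHn (wF n)) => x [i /=].
rewrite ltnS leq_eqVlt => /orP[/eqP ->|lin] Fx; first by right.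
by left; exists i.
Qed.

(** An element of [U] is bounded, hence stays in one coarse component, so the trace of [star K U] on
    a component lies in the star of the trace of [K]. *)
Lemma weakly_bounded_star K U :
  weakly_bounded K -> unif_bounded U -> weakly_bounded (star K U).
Proof.
move=> wK uU x.
apply: sub_ls_bounded (ls_bounded_star _ _ (wK x) uU).
move=> y [[C [UC [k [Ck Kk]]] Cy] xy].
exists C => //; split=> //; exists k; split=> //; split=> //.
apply: coarse_component_trans xy _.
exact: sub_coarse_component (unif_bounded_ls_bounded _ _ uU UC) Cy _ Ck.
Qed.

(** The part of the star outside [N] is the least exceptional set, and adjoining singletons turns a
    uniformly bounded family into a cover. *)
Lemma coarse_neighbourhoodP A N : coarse_neighbourhood A N <->
  A `<=` N /\ forall U, unif_bounded U -> weakly_bounded (star A U `\` N).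
Proof.
split=> -[AN cAN]; split=> // U uU.
  have [K wK AK] := cAN _ (unif_bounded_coverU _ uU).
  apply: sub_weakly_bounded wK => x [[B [UB BA] Bx] nNx].
  by case: (AK x) => //; exists B => //; split=> //; left.
exists (star A U `\` N); first by apply: cAN; case: uU.
by move=> x Ax; have [|nNx] := pselect (N x); [left|right].
Qed.

End LargeScaleTheory.

(** * Boundedness in a subspace compared with the ambient space *)

Section SubspaceLargeScale.
Context {X : lsType} (A : set X).

Lemma unif_bounded_subE (V : set (set (set_type A))) :
  unif_bounded V = unif_bounded [set (set_val : A -> X) @` B | B in V].
Proof. by []. Qed.

Lemma ls_bounded_sub (B : set (set_type A)) :
  ls_bounded B <-> ls_bounded ((set_val : A -> X) @` B).
Proof.
rewrite !ls_boundedP unif_bounded_subE; split=> uB.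
all: apply: (unif_bounded_refine _ _ uB).
  by move=> _ -> _; exists (set_val @` B) => //; exists B.
by move=> _ [_ -> <-] _; exists (set_val @` B).
Qed.

Lemma coarse_component_sub (a b : set_type A) :
  coarse_component a b <-> coarse_component (set_val a : X) (set_val b).
Proof. by rewrite !coarse_componentP ls_bounded_sub image_setU !image_set1. Qed.

(** Components of [A] are traces of components of [X], and a component of [X] that misses the image
    of [K] contributes the empty set. *)
Lemma weakly_bounded_sub (K : set (set_type A)) :
  weakly_bounded K <-> weakly_bounded ((set_val : A -> X) @` K).
Proof.
split=> wK x.
  have [[_ [[k Kk <-] xk]]|/nonemptyPn->] :=
    pselect ((set_val @` K `&` coarse_component x) !=set0); last exact: ls_bounded0.
  have /ls_bounded_sub := wK k; apply: sub_ls_bounded.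
  move=> _ [[a Ka <-] xa]; exists a => //; split=> //; apply/coarse_component_sub.
  exact: coarse_component_trans (coarse_component_sym _ _ xk) xa.
apply/ls_bounded_sub; apply: sub_ls_bounded (wK (set_val x)).
by move=> _ [a [Ka xa] <-]; split; [exists a|apply/coarse_component_sub].
Qed.

End SubspaceLargeScale.

(** * Slow oscillation through sets of points of large oscillation *)

Definition oscillation_set {R : realType} {X : Type} (A : set X) (f : X -> R)
    (U : set (set X)) (e : R) : set X :=
  [set x | exists B y, [/\ U B, (A `&` B) x, (A `&` B) y & e < `|f x - f y|]].

(* Slow oscillation of the restriction of f to A, phrased inside X. *)
Definition slow_on {R : realType} {X : lsType} (A : set X) (f : X -> R) :
    Prop :=
  forall U, unif_bounded U -> forall e, 0 < e ->
    weakly_bounded (oscillation_set A f U e).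

Section SlowOscillation.
Context {R : realType}.

(** An element of [U] with two values more than [e] apart must meet [K], so the oscillation set lies
    in [star K U]. Conversely, an oscillation set itself serves as [K]. *)
Lemma slowly_oscillatingP {X : lsType} (f : X -> R^o) :
  slowly_oscillating f <-> slow_on setT f.
Proof.
split=> fP U uU e e0.
  have [K wK KP] := fP U uU e e0.
  apply: sub_weakly_bounded (weakly_bounded_star _ _ wK uU).
  move=> x [B [y [UB [_ Bx] [_ By] exy]]]; exists B => //; split=> //.
  apply: contrapT => /nonemptyPn BK0.
  have := KP B UB BK0; rewrite ltNge => /negP; apply.
  apply: (@le_trans _ _ (mdist (f y) (f x) : R)%:E); first by rewrite lee_fin ltW.
  apply: ereal_sup_ubound; right; exists (f y, f x) => //.
  by split; [exists y|exists x].
(* [diam] is a supremum; bounding distances by [e / 2] keeps it strictly below [e]. *)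
have e20 : 0 < e / 2 by rewrite divr_gt0.
exists (oscillation_set setT f U (e / 2)); first exact: fP.
move=> B UB BK; apply: (@le_lt_trans _ _ (e / 2)%:E); last first.
  by rewrite lte_fin; lra.
apply: ge_ereal_sup => _ [->|[_ [[y By <-] [x Bx <-]] <-]].
  by rewrite lee_fin ltW.
rewrite lee_fin leNgt; apply/negP => exy.
suff : (B `&` oscillation_set setT f U (e / 2)) x by rewrite BK.
by split=> //; exists B, y.
Qed.

Lemma slow_on_sub {X : lsType} (A : set X) (f : X -> R^o) :
  slowly_oscillating (f \o set_val : set_type A -> R^o) <-> slow_on A f.
Proof.
rewrite slowly_oscillatingP; split=> fP U uU e e0.
  have uUA : unif_bounded [set (set_val : A -> X) @^-1` B | B in U].
    rewrite unif_bounded_subE.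
    apply: (unif_bounded_refine _ _ uU) => _ [_ [B UB <-] <-] _.
    by exists B => // _ [a Ba <-].
  have /weakly_bounded_sub := fP _ uUA e e0; apply: sub_weakly_bounded.
  move=> x [B [y [UB [/mem_set Ax Bx] [/mem_set Ay By] exy]]].
  exists (SigSub Ax) => //; exists (set_val @^-1` B), (SigSub Ay); split=> //.
  by exists B.
apply/weakly_bounded_sub; apply: sub_weakly_bounded (fP _ uU e e0).
move=> _ [a [B [b [UB [_ Ba] [_ Bb] eab]]] <-].
exists (set_val @` B), (set_val b); split=> //.
- by exists B.
- by split; [exact: set_valP|exists a].
- by split; [exact: set_valP|exists b].
Qed.

End SlowOscillation.

(** * Hybrid neighbourhoods and functions controlled by their sublevel sets *)

Lemma sub_hybrid_neighbourhood {X : hlsType} (A B M N : set X) :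
  A `<=` B -> M `<=` N -> hybrid_neighbourhood B M -> hybrid_neighbourhood A N.
Proof.
move=> AB MN [[U [oU BU UM]] /coarse_neighbourhoodP[BM cBM]]; split.
  exists U; split=> //; last exact: subset_trans MN.
  by apply: subset_trans BU; exact: closureS.
apply/coarse_neighbourhoodP; split=> [|V uV]; first by move=> x /AB/BM/MN.
apply: sub_weakly_bounded (cBM V uV) => x [/(starS _ _ _ AB) Bx nNx].
by split=> // /MN.
Qed.

Section Levels.
Context {R : realType} {X : hlsType}.

Lemma levels_continuous (f : X -> R^o) :
  (forall r s : R, r < s ->
     topological_neighbourhood [set x | f x <= r] [set x | f x <= s]) ->
  continuous f.
Proof.
move=> fP x; apply/cvgrPdist_le => e e0.
have [|U [oU xU Ue]] := fP (f x) (f x + e); first lra.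
have [|V [_ xV Ve]] := fP (f x - e) (f x - e / 2); first lra.
have Ux : nbhs x U.
  by apply: open_nbhs_nbhs; split=> //; apply: xU; apply: subset_closure => /=.
have Vx : nbhs x (~` closure [set y | f y <= f x - e]).
  apply: open_nbhs_nbhs; split; first exact/closed_openC/closed_closure.
  by move=> /xV/Ve /=; lra.
apply: filterS2 Ux Vx => y /Ue /= fy nVy.
rewrite ler_norml; apply/andP; split; first lra.
suff : f x - e < f y by lra.
by rewrite ltNge; apply/negP => yV; apply: nVy; exact: subset_closure.
Qed.

(** A grid of step [h] has finitely many points in [0,1], so a finite union of weakly bounded sets
    [F i] catches every large oscillation. *)
Lemma levels_slow (f : X -> R^o) : (forall x, 0 <= f x <= 1) ->
  (forall r s : R, r < s ->
     coarse_neighbourhood [set x | f x <= r] [set x | f x <= s]) ->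
  slow_on setT f.
Proof.
move=> f01 fP U uU e e0.
pose n := Num.Def.archi_bound (2 / e).
pose h : R := n.+1%:R^-1.
have n0 : 0 < n.+1%:R :> R by rewrite ltr0n.
have h0 : 0 < h by rewrite invr_gt0.
have he : 2 * h < e.
  rewrite ltr_pdivrMr// mulrC -ltr_pdivrMr//.
  apply: lt_trans (archi_boundP _) _; first by rewrite divr_ge0// ltW.
  by rewrite ltr_nat.
pose F i := star [set x | f x <= i%:R * h] U `\` [set x | f x <= i%:R * h + h].
have wF i : weakly_bounded (F i).
  have ih : i%:R * h < i%:R * h + h by rewrite ltrDl.
  by have /coarse_neighbourhoodP[_] := fP _ _ ih; exact.
(* The smaller value is at most 1, which is [(n + 1) * h], so the grid point above it has index at
   most [n + 2]. The union catches the point with the larger value, its star also the other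
   point. *)
have wS := weakly_bounded_star _ _ (weakly_bounded_bigcup _ n.+3 wF) uU.
apply: sub_weakly_bounded wS.
(* The larger of the two values exceeds by h the grid point just above the
   smaller one. *)
have key B x y : U B -> B x -> B y -> e < f y - f x ->
    (\bigcup_(i in `I_n.+3) F i) y.
  move=> UB Bx By exy.
  have fxh : 0 <= f x / h by rewrite divr_ge0 ?(ltW h0)//; have /andP[] := f01 x.
  pose i := Num.truncn (f x / h).
  have /andP[ix xi] := truncn_itv fxh.
  move: ix xi; rewrite ler_pdivlMr// ltr_pdivrMr// -/i => ix xi.
  exists i.+1.
    rewrite /= !ltnS -(ler_nat R) -(ler_pM2r h0) (le_trans ix)//.
    by rewrite /h mulfV ?gt_eqF//; have /andP[] := f01 x.
  split; first by exists B => //; split=> //; exists x; split=> //=; exact: ltW.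
  by apply/negP; rewrite -ltNge; move: xi ix; rewrite -natr1 mulrDl mul1r; lra.
move=> x [B [y [UB [_ Bx] [_ By] exy]]].
exists B => //; split=> //; have [fxy|fxy] := leP (f x) (f y).
  exists y; split=> //; apply: key UB Bx By _.
  by move: exy; rewrite ler0_norm; lra.
exists x; split=> //; apply: key UB By Bx _.
by move: exy; rewrite gtr0_norm; lra.
Qed.

End Levels.

(** * Urysohn functions from dyadic chains of closed sets *)

Section Urysohn.
Context {R : realType} {X : hlsType}.

Let chain (D : nat -> set X) :=
  forall k, closed (D k) /\ hybrid_neighbourhood (D k) (D k.+1).

(* [dyadic mid D n k] approximates the sublevel set at k / 2 ^ n. *)
Let dyadic (mid : set X -> set X -> set X) (D : nat -> set X) :=
  fix loop n := if n is n'.+1 then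
    fun k =>
      if odd k then mid (loop n' k./2) (loop n' k./2.+1) else loop n' k./2
  else D.

Lemma hls_normal_separation (A N : set X) : hls_normal X ->
  closed A -> hybrid_neighbourhood A N ->
  exists f : X -> R^o, [/\ continuous f, slow_on setT f,
    forall x, 0 <= f x <= 1, forall x, A x -> f x = 0 &
    forall x, ~ N x -> f x = 1].
Proof.
move=> nX cA AN.
have [V0 [cV0 AV0 V0N]] := nX A N cA AN.
have /choice[mid midP] : forall AN : set X * set X, exists V,
    closed AN.1 -> hybrid_neighbourhood AN.1 AN.2 ->
    [/\ closed V, hybrid_neighbourhood AN.1 V & hybrid_neighbourhood V AN.2].
  move=> [B M].
  have [[cB BM]|nBM] := pselect (closed B /\ hybrid_neighbourhood B M).
    by have [V VP] := nX B M cB BM; exists V.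
  by exists set0 => cB BM; case: nBM.
(* Index 1 carries [V0] instead of [N] because the sets of a chain must be closed; from index 2 on
   stands the whole space. *)
pose D := dyadic (fun B M => mid (B, M))
  (fun k => if k is k'.+1 then if k' is 0%N then V0 else setT else A).
have hT (B : set X) : hybrid_neighbourhood B setT.
  split; first by exists setT; split=> //; exact: openT.
  apply/coarse_neighbourhoodP; split=> // U uU.
  by rewrite setDT; exact: weakly_bounded0.
have h0 (B : set X) : hybrid_neighbourhood set0 B.
  split; first by exists set0; rewrite closure0; split=> //; exact: open0.
  apply/coarse_neighbourhoodP; split=> // U uU.
  by apply: sub_weakly_bounded weakly_bounded0 => x [[C [_ [y []]]]].
have chainD n : chain (D n).
  elim: n => [[|[|k]]|n IHn k] /=; [by split..| |].
    by split=> //; exact: closedT.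
  have [ch hh] := IHn k./2.
  have [cm hm mh] := midP (D n k./2, D n k./2.+1) ch hh.
  (* An even [k] leads from an old set to a new [mid], an odd one from that [mid] to the next old
     set. *)
  by rewrite uphalf_half; case: odd.
have D_scale n m k : D (m + n)%N (k * 2 ^ m)%N = D n k.
  elim: m => [|m IHm]; first by rewrite muln1.
  by rewrite addSn /= expnS mulnCA mul2n odd_double doubleK.
have D_mono n i j : (i <= j)%N -> D n i `<=` D n j.
  move=> /subnK <-; elim: (j - i)%N => // k IHk.
  by move=> x /IHk; have [_ [_ [+ _]]] := chainD n (k + i)%N; exact.
(* Both sets reappear at depth [m + n], where [D_mono] compares them. *)
have D_le m j n k : (j%:R / 2 ^+ m : R) <= k%:R / 2 ^+ n -> D m j `<=` D n k.
  rewrite ler_pdivrMr ?exprn_gt0// mulrAC ler_pdivlMr ?exprn_gt0//.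
  rewrite -!natrX -!natrM ler_nat => jk.
  by rewrite -(D_scale m n) -(D_scale n m) addnC; exact: D_mono.
pose S x : set R := [set r | r = 1 \/ exists n k, D n k x /\ r = k%:R / 2 ^+ n].
have S0 x : S x !=set0 by exists 1; left.
have S_ge0 x : lbound (S x) 0.
  by move=> _ [->|[n [k [_ ->]]]]//; rewrite divr_ge0// exprn_ge0.
pose f x : R^o := inf (S x).
have f_le x r : S x r -> f x <= r.
  by move=> Sr; apply: ge_inf => //; exists 0; exact: S_ge0.
have f01 x : 0 <= f x <= 1.
  by apply/andP; split; [exact: lb_le_inf|apply: f_le; left].
have fP (r s : R) : r < s ->
    hybrid_neighbourhood [set x | f x <= r] [set x | f x <= s].
  move=> rs.
  have [s1|s1] := leP 1 s.
    apply: sub_hybrid_neighbourhood (hT setT) => [//|x _ /=].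
    by apply: le_trans s1; case/andP: (f01 x).
  have [r0|r0] := ltP r 0.
    apply: sub_hybrid_neighbourhood (h0 set0) => [x /=|//].
    by rewrite leNgt (lt_le_trans r0)//; case/andP: (f01 x).
  (* With [2 / 2 ^ n < s - r], two consecutive dyadic numbers [(k + 1) / 2 ^ n] and
     [(k + 2) / 2 ^ n] fit between [r] and [s]. *)
  pose n := Num.Def.archi_bound (2 / (s - r)).
  have n0 : 0 < 2 ^+ n :> R by rewrite exprn_gt0.
  have : 2 / (s - r) < 2 ^+ n by exact: upper_nthrootP.
  rewrite ltr_pdivrMr ?subr_gt0// => ns.
  have /andP[] := truncn_itv (mulr_ge0 r0 (ltW n0)).
  set k := Num.truncn _ => kr rk.
  have ks : k.+2%:R / 2 ^+ n <= s.
    rewrite ler_pdivrMr// -2!natr1; move: ns.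
    by rewrite mulrBr mulrC [_ * r]mulrC; lra.
  have [_] := chainD n k.+1; apply: sub_hybrid_neighbourhood => x /= fx; last first.
    by apply: le_trans ks; apply: f_le; right; exists n, k.+2.
  have : f x < k.+1%:R / 2 ^+ n by rewrite (le_lt_trans fx)// ltr_pdivlMr.
  move=> /(inf_lt (S0 x))[_ [->|[m [j [Dx ->]]]] jk]; last first.
    exact: D_le (ltW jk) _ Dx.
  suff : k.+1%:R / 2 ^+ n <= k.+2%:R / 2 ^+ n :> R by move: jk ks s1; lra.
  by rewrite ler_pM2r ?invr_gt0// ler_nat.
exists f; split=> //.
- by apply: levels_continuous => r s /fP[].
- by apply: levels_slow => // r s /fP[].
- move=> x Ax; apply/eqP; rewrite eq_le; case/andP: (f01 x) => -> _; rewrite andbT.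
  by apply: f_le; right; exists 0%N, 0%N; rewrite mul0r.
- move=> x nNx; apply/eqP; rewrite eq_le; case/andP: (f01 x) => _ -> /=.
  apply: lb_le_inf => // _ [->|[m [j [Dx ->]]]] //; rewrite leNgt; apply/negP => j1.
  (* The set of a dyadic number below 1 lies in [D 0 1], which is [V0], hence in [N]. *)
  apply: nNx; case: V0N => _ [+ _]; apply.
  by apply: (D_le m j 0%N 1%N) => //; rewrite expr0 divr1 ltW.
Qed.
End Urysohn.

(** * Linear combinations and uniform limits *)

Section UniformLimit.
Context {R : realType} {X : lsType}.
Implicit Types (A B : set X) (f g : X -> R).

Lemma sub_slow_on A B f : A `<=` B -> slow_on B f -> slow_on A f.
Proof.
move=> AB fP U uU e e0; apply: sub_weakly_bounded (fP U uU e e0).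
by move=> x [C [y [UC [/AB Ax Cx] [/AB Ay Cy] exy]]]; exists C, y.
Qed.

Lemma slow_on_lincomb A f g (c : R) :
  slow_on A f -> slow_on A g -> slow_on A (fun x => f x + c * g x).
Proof.
move=> fP gP U uU e e0.
have c0 : 0 < `|c| + 1 by rewrite ltr_wpDl.
(* If [f] varies by at most [e / 2], then [g] must vary by more than [d]; the [+ 1] covers
   [c = 0]. *)
pose d := e / 2 / (`|c| + 1).
have d0 : 0 < d by rewrite !divr_gt0.
have e20 : 0 < e / 2 by rewrite divr_gt0.
apply: sub_weakly_bounded (weakly_boundedU _ _ (fP U uU _ e20) (gP U uU _ d0)).
move=> x [B [y [UB Bx By exy]]].
have [fxy|fxy] := ltP (e / 2) `|f x - f y|; first by left; exists B, y.
right; exists B, y; split=> //; rewrite ltr_pdivrMr//.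
have : `|c| * `|g x - g y| <= `|g x - g y| * (`|c| + 1).
  by rewrite mulrC ler_wpM2l// lerDl.
move: exy; rewrite (_ : _ - _ = f x - f y + c * (g x - g y)); last by ring.
by move=> exy; have := ler_normD (f x - f y) (c * (g x - g y)); rewrite normrM; lra.
Qed.

Lemma slow_on_uniform_limit A f :
  (forall e, 0 < e -> exists2 g : X -> R, slow_on A g &
    forall x, `|f x - g x| <= e) ->
  slow_on A f.
Proof.
move=> fP U uU e e0; have e40 : 0 < e / 4 by rewrite divr_gt0.
have [g gP fg] := fP _ e40; apply: sub_weakly_bounded (gP U uU _ e40).
move=> x [B [y [UB Bx By exy]]]; exists B, y; split=> //.
have := fg x; have := fg y; rewrite distrC => fgy fgx.
have := ler_normD (f x - g x + (g x - g y)) (g y - f y).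
have := ler_normD (f x - g x) (g x - g y).
rewrite (_ : f x - g x + (g x - g y) + _ = f x - f y); last by ring.
lra.
Qed.

End UniformLimit.

Lemma continuous_uniform_limit {R : realType} {X : topologicalType}
    (f : X -> R^o) :
  (forall e : R, 0 < e -> exists2 g : X -> R^o, continuous g &
    forall x, `|f x - g x| <= e) ->
  continuous f.
Proof.
move=> fP x; apply/cvgrPdist_le => e e0; have e40 : 0 < e / 4 by rewrite divr_gt0.
have [g gP fg] := fP _ e40.
have /cvgrPdist_le/(_ _ e40) := gP x; apply: filterS => y gxy.
have := fg x; have := fg y; rewrite distrC => fgy fgx.
have := ler_normD (f x - g x + (g x - g y)) (g y - f y).
have := ler_normD (f x - g x) (g x - g y).
rewrite (_ : f x - g x + (g x - g y) + _ = f x - f y); last by ring.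
lra.
Qed.

Lemma continuous_lincomb {R : realType} {X : topologicalType}
    (f g : X -> R^o) (c : R) :
  continuous f -> continuous g -> continuous (fun x => f x + c * g x : R^o).
Proof. by move=> cf cg x; apply: cvgD (cf x) (cvgMr (cg x)). Qed.

(** Since [4 / 9] is at most [1 / 2], the power with exponent [2 * n] is at most [1 / 2 ^ n]. *)
Lemma exp_twothirds_lt {R : realType} (e : R) : 0 < e -> exists n, (2 / 3) ^+ n < e.
Proof.
move=> e0; pose n := Num.Def.archi_bound (e^-1); exists (2 * n)%N.
have ne : e^-1 < 2 ^+ n by exact: upper_nthrootP.
rewrite exprM; apply: (@le_lt_trans _ _ (2^-1 ^+ n)).
  by apply: lerXn2r; rewrite ?nnegrE; lra.
by rewrite exprVn -[e]invrK ltf_pV2// posrE ?exprn_gt0// invr_gt0.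
Qed.

(** * Tietze extension by iterated one-sided approximation *)

Section Tietze.
Context {R : realType} {X : hlsType}.
Context (nX : hls_normal X) (A : set X) (cA : closed A).

(** [u] is a Urysohn function, 0 where [f] is in the lowest third of [[0, M]] and 1 where it is in
    the highest. The remainder stays nonnegative, so the approximations increase to [f] on [A]. *)
Lemma tietze_step (f : X -> R^o) (M : R) : 0 < M ->
  {within A, continuous f} -> slow_on A f -> (forall x, A x -> 0 <= f x <= M) ->
  exists u : X -> R^o, [/\ continuous u, slow_on setT u,
    forall x, 0 <= u x <= 1 &
    forall x, A x -> 0 <= f x - M / 3 * u x <= M * (2 / 3)].
Proof.
move=> M0 cf sf f0M.
have closedA (C : set R^o) : closed C -> closed (A `&` f @^-1` C).
  move=> cC; have /closed_subspaceP[V cV] := (continuous_closedP _).1 cf C cC.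
  by rewrite setIC [_ `&` A]setIC => <-; exact: closedI.
have cL : closed (A `&` [set x | f x <= M / 3])
  := closedA _ (@closed_le R (M / 3)).
have cH : closed (A `&` [set x | M * (2 / 3) <= f x])
  := closedA _ (@closed_ge R (M * (2 / 3))).
have [|u [cu su u01 uL uH]] := hls_normal_separation (R := R) _
    (~` (A `&` [set x | M * (2 / 3) <= f x])) nX cL.
  split.
    exists (~` (A `&` [set x | M * (2 / 3) <= f x])); split=> //.
      exact: closed_openC.
    rewrite -(closure_id _).1// => x [_ /= fL] [_ /=]; lra.
  apply/coarse_neighbourhoodP; split=> [x [_ /= fL] [_ /=]|U uU]; first lra.
  (* Between the low and the high set [f] changes by at least [M / 3], strictly more than
     [M / 6]. *)
  have M6 : 0 < M / 6 by lra.
  apply: sub_weakly_bounded (sf U uU _ M6).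
  move=> y [[B [UB [x [Bx [Ax /= fx]]]] By] /contrapT[Ay /= fy]].
  by exists B, x; split=> //; rewrite ger0_norm; lra.
exists u; split=> // x Ax; have := f0M x Ax; have := u01 x.
have [fL _|fL u1] := leP (f x) (M / 3).
  by rewrite uL//; lra.
have [fH|fH] := leP (M * (2 / 3)) (f x).
  by rewrite uH; [lra|move=> /(_ _); apply].
have : 0 <= M / 3 * u x <= M / 3.
  by rewrite mulr_ge0 ?ler_piMr//; lra.
lra.
Qed.

Lemma hls_tietze (f : X -> R^o) :
  {within A, continuous f} -> slow_on A f -> (forall x, A x -> 0 <= f x <= 1) ->
  exists g : X -> R^o, [/\ continuous g, slow_on setT g,
    forall x, 0 <= g x <= 1 & forall x, A x -> g x = f x].
Proof.
move=> cf sf f01.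
pose q : R := 2 / 3.
have q0 n : 0 < q ^+ n by rewrite exprn_gt0// /q; lra.
(* The invariant leaves room [q ^ n] below 1 on all of [X], so adding the next correction keeps
   values in [0,1]. *)
pose P n (g : X -> R^o) := [/\ continuous g, slow_on setT g,
  forall x, 0 <= g x <= 1 - q ^+ n & forall x, A x -> 0 <= f x - g x <= q ^+ n].
have /choice[next nextP] : forall ng : nat * (X -> R^o), exists g : X -> R^o,
    P ng.1 ng.2 -> P ng.1.+1 g /\
      forall x, ng.2 x <= g x <= ng.2 x + (q ^+ ng.1 - q ^+ ng.1.+1).
  move=> [n g] /=; have [[cg sg g0 gf]|nP] := pselect (P n g); last by exists g.
  have [| | |u [cu su u01 ug]] :=
    tietze_step (fun x => f x + -1 * g x) _ (q0 n).
  - by apply: continuous_lincomb => //; exact: continuous_subspaceT.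
  - by apply: slow_on_lincomb => //; exact: sub_slow_on sg.
  - by move=> x /gf; rewrite mulN1r.
  have qS : q ^+ n.+1 = q ^+ n * (2 / 3) by rewrite exprSr.
  have qu x : 0 <= q ^+ n / 3 * u x <= q ^+ n / 3.
    have := u01 x; have := q0 n; move: (q ^+ n) => M *.
    by rewrite mulr_ge0 ?ler_piMr//; lra.
  exists (fun x => g x + q ^+ n / 3 * u x) => _; split; last first.
    by move=> x; rewrite qS; have := qu x; lra.
  split; [exact: continuous_lincomb|exact: slow_on_lincomb| |].
    by move=> x; rewrite qS; have := qu x; have := g0 x; lra.
  by move=> x /ug; rewrite qS; lra.
pose G := fix G n : X -> R^o := if n is m.+1 then next (m, G m) else fun=> 0.
have GP n : P n (G n).
  elim: n => [|n /(nextP (n, G n))[]//]; split.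
  - by move=> x; exact: cvg_cst.
  - move=> U uU e e0; apply: sub_weakly_bounded weakly_bounded0.
    by move=> x [B [y [_ _ _]]]; rewrite /= subrr normr0 ltNge ltW.
  - by move=> x; rewrite /= expr0; lra.
  - by move=> x /f01; rewrite /= expr0; lra.
have GS n x : G n x <= G n.+1 x <= G n x + (q ^+ n - q ^+ n.+1).
  by have [_] := nextP (n, G n) (GP n); apply.
have Gmn n m x : (n <= m)%N -> G n x <= G m x <= G n x + (q ^+ n - q ^+ m).
  move=> /subnK <-; elim: (m - n)%N => [|k IHk]; first by rewrite add0n; lra.
  by have := GS (k + n)%N x; rewrite addSn; lra.
pose S x : set R := range (fun n => G n x).
(* Increments telescope, so every later term exceeds [G n] by at most [q ^ n] and this supremum is a
   uniform limit. *)
pose g x : R^o := sup (S x).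
have GleS n m x : G m x <= G n x + q ^+ n.
  have [nm|/ltnW mn] := leqP n m.
    by have := Gmn n m x nm; have := q0 m; lra.
  by have := Gmn m n x mn; have := q0 n; lra.
have S0 x : S x !=set0 by exists (G 0%N x), 0%N.
have Gg n x : G n x <= g x <= G n x + q ^+ n.
  apply/andP; split.
    apply: ub_le_sup; last by exists n.
    by exists (G 0%N x + q ^+ 0) => _ [m _ <-].
  by apply: ge_sup => // _ [m _ <-].
have gG e : 0 < e -> exists n, forall x, `|g x - G n x| <= e.
  move=> e0; have [n ne] := exp_twothirds_lt _ e0; exists n => x.
  by have := Gg n x; rewrite -/q in ne; move=> ?; rewrite ger0_norm; lra.
exists g; split.
- apply: continuous_uniform_limit => e /gG[n Gn]; exists (G n) => //.
  by case: (GP n).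
- apply: slow_on_uniform_limit => e /gG[n Gn]; exists (G n) => //.
  by case: (GP n).
- by move=> x; have := Gg 0%N x; rewrite expr0 /=; lra.
- move=> x Ax; apply/eqP; rewrite -subr_eq0 -normr_le0; apply/ler_addgt0Pr => e e0.
  rewrite add0r; have [n ne] := exp_twothirds_lt _ e0; rewrite -/q in ne.
  have := Gg n x; have [_ _ _ /(_ x Ax)] := GP n => fG gGn.
  by rewrite ler_norml; lra.
Qed.
End Tietze.

(** * Normality from the extension property *)

Section Converse.
Context {X : hlsType}.

(** If [x] in [star A V] is off the interior of [N], an open [C] in [W] around [x] contains some [y]
    off [N]. Such [y] lie in an enlarged star of [A], so they form a weakly bounded set, whose star
    under [W] contains [x]. *)
Lemma hybrid_neighbourhood_interior (A N : set X) :
  hybrid_neighbourhood A N -> hybrid_neighbourhood A N°.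
Proof.
move=> [[U [oU AU UN]] /coarse_neighbourhoodP[_ cAN]].
have UNi : U `<=` N° by rewrite -open_subsetE.
split; first by exists U.
apply/coarse_neighbourhoodP; split=> [x /subset_closure/AU/UNi//|V uV].
have [W [uW cW] oW] := @open_unif_bounded_cover X.
have uVW : unif_bounded (stars (V `|` range (fun x => [set x])) W).
  by apply: unif_bounded_stars => //; case: (unif_bounded_coverU _ uV).
have wK := cAN _ uVW.
apply: sub_weakly_bounded (weakly_bounded_star _ _ wK uW).
move=> x [[B [VB [a [Ba Aa]]] Bx] nNx].
apply: contrapT => nKx; apply: nNx.
have : (\bigcup_(C in W) C) x by rewrite cW.
case=> C WC Cx; rewrite /interior/= nbhsE; exists C; first by split=> //; exact: oW.
move=> y Cy; apply: contrapT => nNy; apply: nKx.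
exists C => //; split=> //; exists y; split=> //; split=> //.
exists (star B W); first split.
- by exists B => //; left.
- exists a; split=> //; exact: sub_star_cover.
- by exists C => //; split=> //; exists x.
Qed.

Context {R : realType}.

Lemma sublevel_hybrid_neighbourhood (g : X -> R^o) (r s : R) :
  continuous g -> slow_on setT g -> r < s ->
  hybrid_neighbourhood [set x | g x <= r] [set x | g x < s].
Proof.
move=> cg sg rs; split.
  exists [set x | g x < s]; split=> //.
    by apply: (open_comp (f := g) (D := [set y | y < s])) => //; exact: open_lt.
  rewrite -(closure_id _).1; first by move=> x /=; lra.
  by apply: (closed_comp (f := g) (D := [set y | y <= r])) => //; exact: closed_le.
apply/coarse_neighbourhoodP; split=> [x /=|U uU]; first lra.
have e0 : 0 < (s - r) / 2 by lra.
apply: sub_weakly_bounded (sg U uU _ e0) => y [[B [UB [x [Bx /= gx]]] By] /= gy].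
exists B, x; split=> //; move: gy => /negP; rewrite -leNgt => gy.
by rewrite ger0_norm; lra.
Qed.

Lemma hls_normal_of_extension :
  (forall A : set X, closed A ->
   forall f : set_type A -> R^o,
     continuous f -> slowly_oscillating f ->
     (forall a, f a \in `[0, 1]) ->
     exists g : X -> R^o,
       [/\ continuous g, slowly_oscillating g,
           forall x, g x \in `[0, 1] &
           forall a : set_type A, g (set_val a) = f a]) ->
  hls_normal X.
Proof.
move=> ext A N cA /hybrid_neighbourhood_interior[_ /coarse_neighbourhoodP[AN cAN]].
pose B := ~` N°.
have cB : closed B by apply: open_closedC; exact: open_interior.
pose f x : R^o := if `[< A x >] then 0 else 1.
have fA x : A x -> f x = 0 by rewrite /f => Ax; rewrite asboolT.
have fB x : B x -> f x = 1.
  by rewrite /f => Bx; rewrite asboolF// => /AN.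
have cf : {within A `|` B, continuous f}.
  apply: withinU_continuous => //.
    apply: (@subspace_eq_continuous _ _ _ (fun=> 0 : R^o)); last first.
      by move=> x; exact: cvg_cst.
    by move=> x /set_mem/fA.
  apply: (@subspace_eq_continuous _ _ _ (fun=> 1 : R^o)); last first.
    by move=> x; exact: cvg_cst.
  by move=> x /set_mem/fB.
have sf : slow_on (A `|` B) f.
  move=> U uU e e0; have wK := cAN _ uU.
  apply: sub_weakly_bounded (weakly_bounded_star _ _ wK uU).
  move=> x [C [y [UC [ABx Cx] [ABy Cy] exy]]]; exists C => //; split=> //.
  (* An element of [U] meeting both [A] and [B] meets the weakly bounded part of [star A U] outside
     the interior of [N]. *)
  have key z w : A z -> B w -> C z -> C w ->
      C `&` (star A U `\` N°) !=set0.
    by move=> Az Bw Cz Cw; exists w; do 2!split=> //; exists C => //; split=> //; exists z.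
  move: exy; case: ABx ABy => [Ax|Bx] [Ay|By].
  - by rewrite !fA// subrr normr0 ltNge ltW.
  - by move=> _; exact: key Ax By Cx Cy.
  - by move=> _; exact: key Ay Bx Cy Cx.
  - by rewrite !fB// subrr normr0 ltNge ltW.
have [||a|g [cg /slowly_oscillatingP sg g01 gf]] :=
    ext _ (closedU cA cB) (sigL (A `|` B) f).
- exact/subspace_sigL_continuousP.
- exact/slow_on_sub.
- by rewrite /sigL /= /f in_itv /=; case: asboolP => _; lra.
have gE x : (A `|` B) x -> g x = f x.
  by move=> /mem_set ABx; exact: gf (SigSub ABx).
exists [set x | g x <= 1 / 2]; split.
- by apply: (closed_comp (f := g) (D := [set y | y <= 1 / 2])) => //; exact: closed_le.
- have h01 : (0 : R) < 1 / 2 by lra.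
  have gn := sublevel_hybrid_neighbourhood _ _ _ cg sg h01.
  apply: sub_hybrid_neighbourhood gn.
    by move=> x Ax /=; rewrite gE ?fA//; left.
  by move=> x /=; lra.
- have h11 : 1 / 2 < (1 : R) by lra.
  have gn := sublevel_hybrid_neighbourhood _ _ _ cg sg h11.
  apply: sub_hybrid_neighbourhood gn => //.
  move=> x /= gx; apply: interior_subset; apply: contrapT => Bx.
  by move: gx; rewrite gE ?fB ?ltxx//; right.
Qed.

End Converse.

(** * The equivalence, with functions moved between the subtype and [X] *)

Theorem corollary8p7 (R : realType) (X : hlsType) :
  hls_normal X <->
  (forall A : set X, closed A ->
   forall f : set_type A -> R^o,
     continuous f -> slowly_oscillating f ->
     (forall a, f a \in `[0, 1]) ->
     exists g : X -> R^o,
       [/\ continuous g, slowly_oscillating g,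
           forall x, g x \in `[0, 1] &
           forall a : set_type A, g (set_val a) = f a]).
Proof.
split=> [nX A cA f cf sf f01|]; last exact: hls_normal_of_extension.
(* The default value 0 off [A] is harmless: [hls_tietze] refers to [F] only on [A]. *)
pose F : X -> R^o := 'valL_0 f.
have FK : sigL A F = f by exact: valLK.
have FE (a : set_type A) : F (set_val a) = f a by rewrite -[in RHS]FK.
have [|||g [cg sg g01 gF]] := hls_tietze nX A cA F.
- by apply/subspace_sigL_continuousP; rewrite FK.
- by apply/slow_on_sub; rewrite -/(sigL A F) FK.
- by move=> x /mem_set Ax; have := f01 (SigSub Ax); rewrite in_itv/= -FE.
exists g; split=> //; first exact/slowly_oscillatingP.
by move=> a; rewrite gF ?FE//; exact: set_valP.
Qed.
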